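(* Suppose that $f:[0,1]\to\mathbb{R}$ is a (Lebesgue measurable) approximately continuous function and that, for each $x_0\in[0,1)$ and each (Lebesgue measurable) set $E\subset\mathbb{R}$ having zero density at $0$, $$\limsup_{h\to0^+,\ h\notin E}\frac{f(x_0+h)-f(x_0)}{h}>0,$$ where the $\limsup$ is taken over $h>0$ with $h\notin E$ and $x_0+h\in[0,1]$, and may take the value $+\infty$. Then $f$ is strictly increasing on $[0,1]$.
   Context: All sets and functions are assumed measurable with respect to Lebesgue measure $\lambda$ on $\mathbb{R}$. For a set $E\subset\mathbb{R}$ and an interval $I\subset\mathbb{R}$, the density of $E$ in $I$ is $\Delta(E,I)=\lambda(E\cap I)/\lambda(I)$. The upper density of $E$ at $x$ is $\overline\Delta(E,x)=\limsup_{r\to0}\Delta(E,(x-r,x+r))$, with $r>0$; the lower density $\underline\Delta(E,x)$ is defined with $\liminf$ in place of $\limsup$; if the two agree, their common value is the density $\Delta(E,x)$ of $E$ at $x$. $E$ has zero density at $x$ if $\Delta(E,x)=0$. A function $f$ is approximately continuous at $x_0$ if there is a set $E$ with zero density at $x_0$ such that the limit of $f(x)$ as $x\to x_0$ with $x\notin E$ ($x$ in the domain of $f$) equals $f(x_0)$; $f$ is approximately continuous if this holds at each point of its domain. *)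

(* Defs.v *)
From HB Require Import structures.
From mathcomp Require Import all_boot all_order all_algebra.
From mathcomp Require Import all_classical all_reals all_analysis.
Set Implicit Arguments.
Unset Strict Implicit.
Unset Printing Implicit Defensive.
Import Order.TTheory GRing.Theory Num.Theory.
Import numFieldNormedType.Exports.
Local Open Scope classical_set_scope.
Local Open Scope ring_scope.

(* [lebesgue_measure] lives on the Borel sigma-algebra; Lebesgue measurability
   is measurability for the Caratheodory sigma-algebra, on which
   [completed_lebesgue_measure] is a measure. *)
Definition lebesgue_type (R : realType) : measurableType _ :=
  caratheodory_type ((@wlength R idfun)^*)%mu.

Definition lebesgue_measurable (R : realType) (E : set R) : Prop :=
  measurable (E : set (lebesgue_type R)).

Definition lebesgue_measurable_fun (R : realType) (D : set R) (f : R -> R)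
    : Prop :=
  measurable_fun (D : set (lebesgue_type R)) (f : lebesgue_type R -> R).

Definition density (R : realType) (E I : set R) : \bar R :=
  (completed_lebesgue_measure (E `&` I) / completed_lebesgue_measure I)%E.

Definition upper_density (R : realType) (E : set R) (x : R) : \bar R :=
  limf_esup (fun r : R => density E `]x - r, x + r[) 0^'+.

Definition lower_density (R : realType) (E : set R) (x : R) : \bar R :=
  limf_einf (fun r : R => density E `]x - r, x + r[) 0^'+.

Definition has_density (R : realType) (E : set R) (x : R) (d : \bar R) : Prop :=
  upper_density E x = d /\ lower_density E x = d.

Definition zero_density (R : realType) (E : set R) (x : R) : Prop :=
  has_density E x 0%E.

Definition approx_continuous_at (R : realType) (D : set R) (f : R -> R)
    (x0 : R) : Prop :=
  exists E : set R, [/\ lebesgue_measurable E, zero_density E x0 &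
    f x @[x --> within (D `\` E) x0^'] --> f x0].

(* [f] is viewed as a function with domain [D]; its values off [D] play no
   role. *)
Definition approx_continuous (R : realType) (D : set R) (f : R -> R) : Prop :=
  forall x0 : R, D x0 -> approx_continuous_at D f x0.

Definition upper_right_derivate_off (R : realType) (D : set R) (f : R -> R)
    (x0 : R) (E : set R) : \bar R :=
  limf_esup (fun h : R => ((f (x0 + h) - f x0) / h)%:E)
    (within (~` E `&` [set h | D (x0 + h)]) 0^'+).

(* Main.v *)
Require Import Defs.
From HB Require Import structures.
From mathcomp Require Import all_boot all_order all_algebra.
From mathcomp Require Import all_classical all_reals all_analysis.
From mathcomp Require Import lra.
Set Implicit Arguments.
Unset Strict Implicit.
Unset Printing Implicit Defensive.
Import Order.TTheory GRing.Theory Num.Theory.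
Import numFieldNormedType.Exports.
Local Open Scope classical_set_scope.
Local Open Scope ring_scope.

(** Fix a level [c] and look at [{f >= c}].  Maximizing the length of this set in
    [[p, x]] minus [th * (x - p)] over [x] ([rising_sun]) gives, when
    [f q < c < f p] and [p < q], an interior point [x] to the right of which
    [{f >= c}] has share at most [th], and to the left of which it has share at
    least [th], in every interval of [[p, q]] with endpoint [x].  By approximate
    continuity the first property excludes [f x > c] and the second excludes
    [f x < c], so [f x = c] ([level_point]).  Hence a decrease of [f] produces points [x] such
    that [{f >= f x}] is sparse on the right of [x], with any share [th > 0]
    fixed in advance.

    The derivate hypothesis says that the share can never tend to [0]: taking for
    [E] the translate by [x] of [{f >= f x}] shows that [{f >= f x}] does not
    have zero right density at [x].  To contradict it, the share has to be
    improved at one single point.  [sparse_step] moves a point [x] of share [th]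
    up to a nearby point [x'] with [f x < f x'], whose share is a smaller number
    [th'] at small scales, while at all scales up to half that of [x] it is
    still at most [4 * th].  The room to move up comes from the derivate hypothesis again,
    now with [E] empty: points above [f x] exist arbitrarily close to [x].

    Iterating gives increasing points [x_n], increasing values [f x_n], and shares
    and scales tending to [0].  Let [z] be the limit.  Near [x_(n+1)] most points
    have values at least [f x_n]; if the steps are small with respect to the scale
    at which this holds, it passes to [z], and approximate continuity at [z] gives
    [f z >= f x_n] for all [n].  So [{f >= f z}] is contained in all sets
    [{f >= f x_n}], and it inherits at each scale the share of the corresponding
    [x_n]: its right density at [z] is [0], which is impossible
    ([no_sparse_point]).  Thus [f] is nondecreasing, and strictly so because
    [f] exceeds [f x] at points arbitrarily close to [x] on the right. *)

(** * Lengths of sets in intervals *)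

Section OuterMeasure.
Variable R : realType.
Implicit Types (A B : set R) (a b c d : R).
Local Notation mu := (@completed_lebesgue_measure R).

Lemma mu_ge0 A : (0 <= mu A)%E.
Proof. exact: mu_ext_ge0. Qed.

Lemma le_mu A B : A `<=` B -> (mu A <= mu B)%E.
Proof. exact: (@le_outer_measure _ _ ((@wlength R idfun)^*)%mu). Qed.

Lemma mu_setU A B : (mu (A `|` B) <= mu A + mu B)%E.
Proof. exact: (@outer_measureU2 _ _ ((@wlength R idfun)^*)%mu). Qed.

Lemma mu_itv_oo a b : a <= b -> mu `]a, b[ = (b - a)%:E.
Proof.
move=> ab; transitivity (@lebesgue_measure R `]a, b[) => //.
rewrite lebesgue_measure_itv/= lte_fin; case: ltgtP ab => //= -> _.
by rewrite subrr.
Qed.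

Lemma mu_itv_oc a b : a <= b -> mu `]a, b] = (b - a)%:E.
Proof.
move=> ab; transitivity (@lebesgue_measure R `]a, b]) => //.
rewrite lebesgue_measure_itv/= lte_fin; case: ltgtP ab => //= -> _.
by rewrite subrr.
Qed.

Lemma lebesgue_measurableP A : lebesgue_measurable A <->
  forall X, mu X = (mu (X `&` A) + mu (X `&` ~` A))%E.
Proof. by split; exact. Qed.

(** The interval satisfies Caratheodory's criterion. *)
Lemma mu_cut A a b :
  mu A = (mu (A `&` `]a, b]) + mu (A `&` ~` `]a, b]))%E.
Proof.
have /lebesgue_measurableP -> // : lebesgue_measurable `]a, b]%classic.
by apply: caratheodory_measurable_mu_ext; exact: is_ocitv.
Qed.

Lemma mu_translate_le A (x : R) : (mu [set h | A (x + h)%R] <= mu A)%E.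
Proof.
apply: le_ereal_inf_tmp => _ [F [mF AF] <-]; apply: ge_ereal_inf.
pose G k := [set h | F k (x + h)].
exists (\sum_(k <oo) wlength idfun (G k))%E.
  exists G => //; split=> [k|h /= /AF[k _ Fk]].
    have [[a b] _ Fk] := mF k.
    rewrite /G -Fk; exists (a - x, b - x) => //; apply/seteqP; split=> h /=;
      by rewrite !in_itv/= => /andP[? ?]; apply/andP; split; lra.
  by exists k.
apply: lee_nneseries => [k _ _|k _]; first exact: wlength_ge0.
have [[a b] _ Fk] := mF k.
rewrite /G -Fk; have -> : [set h | `]a, b]%classic (x + h)] = `]a - x, b - x]%classic.
  by apply/seteqP; split=> h /=;
    rewrite !in_itv/= => /andP[? ?]; apply/andP; split; lra.
rewrite /= !wlength_itv/= !lte_fin ltrD2r; case: ifPn => // _.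
by rewrite -!EFinB lee_fin; lra.
Qed.

Lemma mu_translate A (x : R) : mu [set h | A (x + h)] = mu A.
Proof.
apply/eqP; rewrite eq_le mu_translate_le/=.
apply: le_trans (mu_translate_le _ (- x)); apply: le_mu => y /= Ay.
by rewrite addrA subrr add0r.
Qed.

Lemma lebesgue_measurable_translate A (x : R) :
  lebesgue_measurable A -> lebesgue_measurable [set h | A (x + h)].
Proof.
move=> /lebesgue_measurableP mA; apply/lebesgue_measurableP => X.
have := mA [set y | X (- x + y)]; rewrite -(mu_translate _ x) -(mu_translate (_ `&` A) x).
rewrite -(mu_translate (_ `&` ~` A) x).
have -> : [set h | [set y | X (- x + y)] (x + h)] = X.
  by apply/seteqP; split=> h /=; rewrite addrA addNr add0r.
rewrite /= => ->; congr (mu _ + mu _)%E;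
  by apply/seteqP; split=> h /=; rewrite addrA addNr add0r.
Qed.

(** Half-open intervals make [len] exactly additive in the interval, for an
    arbitrary set [A]: the outer measure is cut by intervals. *)
Definition len A a b : R := fine (mu (A `&` `]a, b])).

Lemma lenE A a b : mu (A `&` `]a, b]) = (len A a b)%:E.
Proof.
rewrite /len fineK// ge0_fin_numE ?mu_ge0//.
have [ab|ba] := leP a b.
  by rewrite (le_lt_trans (le_mu (@subIsetr _ A _)))// mu_itv_oc// ltry.
rewrite set_itv_ge ?setI0 -?leNgt ?ltW//.
by rewrite (_ : mu set0 = 0%E)// measure0.
Qed.

Lemma len_ge0 A a b : 0 <= len A a b.
Proof. by rewrite -lee_fin -lenE mu_ge0. Qed.

Lemma len_rev A a b : b <= a -> len A a b = 0.
Proof.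
move=> ba; rewrite /len set_itv_ge ?setI0 -?leNgt//.
by rewrite (_ : mu set0 = 0%E)// measure0.
Qed.

Lemma le_len A B a b c d : A `&` `]a, b] `<=` B `&` `]c, d] ->
  len A a b <= len B c d.
Proof. by move=> AB; rewrite -lee_fin -!lenE le_mu. Qed.

Lemma len_le A a b : a <= b -> len A a b <= b - a.
Proof.
by move=> ab; rewrite -lee_fin -lenE -mu_itv_oc//; exact: le_mu.
Qed.

Lemma len_set0 a b : len set0 a b = 0.
Proof. by rewrite /len set0I (_ : mu set0 = 0%E)// measure0. Qed.

Lemma len_split A a b c : a <= b -> b <= c -> len A a c = len A a b + len A b c.
Proof.
move=> ab bc; apply/EFin_inj; rewrite EFinD -!lenE (mu_cut _ a b).
congr (mu _ + mu _)%E; apply/seteqP; split=> h /=; rewrite !in_itv/=.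
- by move=> [[Ah /andP[h1 h2]] /andP[h3 h4]]; rewrite h3 h4.
- move=> [Ah /andP[h1 h2]]; rewrite h1 h2; do ?split=> //.
  by rewrite (le_trans h2 bc).
- move=> [[Ah /andP[h1 h2]] /negP]; rewrite h1 h2 /= -ltNge => h3.
  by rewrite h3.
- move=> [Ah /andP[h1 h2]]; rewrite h2 (le_lt_trans ab h1); do ?split=> //.
  by apply/negP; rewrite /= -ltNge.
Qed.

Lemma len_cover A B a b : a <= b -> `]a, b] `<=` A `|` B ->
  b - a <= len A a b + len B a b.
Proof.
move=> ab ABab; rewrite -lee_fin (EFinD (len _ _ _)) -!lenE -mu_itv_oc//.
apply: le_trans (mu_setU _ _); rewrite -setIUl; apply: le_mu => y yab.
by split => //; exact: ABab.
Qed.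

Lemma len_translate A (x h : R) :
  len [set t | A (x + t)] 0 h = len A x (x + h).
Proof.
rewrite /len -[in RHS](mu_translate _ x); congr (fine (mu _)).
by apply/seteqP; split=> y /=; rewrite !in_itv/= ltrDl lerD2l.
Qed.

(** The point [x] maximizes the excess [len A p t - th * (t - p)], which is
    continuous in [t]; comparing [x] with the points on each side of it gives the
    two bounds. *)
Lemma rising_sun A p q (th : R) : p <= q ->
  exists x, [/\ p <= x <= q,
    forall t, x <= t <= q -> len A x t <= th * (t - x) &
    forall t, p <= t <= x -> th * (x - t) <= len A t x].
Proof.
move=> pq; pose Phi t := len A p t - th * (t - p).
have cPhi : {within `[p, q], continuous Phi}.
  have clen : {within `[p, q], continuous (len A p)}.
    apply: continuous_subspaceT => t.
    have lip s u : s <= u -> 0 <= len A p u - len A p s <= u - s.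
      move=> su; have [pu|up] := leP p u; last first.
        rewrite !len_rev ?(ltW up) ?(le_trans su (ltW up))//.
        by rewrite subrr lexx subr_ge0.
      have [ps|sp] := leP p s.
        rewrite (len_split _ ps su) addrC addKr len_ge0/=.
        exact: len_le.
      rewrite (@len_rev A p s) ?(ltW sp)// subr0 len_ge0/=
         (le_trans (len_le _ pu))//; lra.
    apply/cvgrPdist_le => e e0; near=> s.
    have : `|t - s| <= e.
      near: s; exact: cvgr_dist_le.
    have [ts|st] := leP t s.
      have := lip _ _ ts; rewrite !(distrC _ s) !(distrC _ (len A p s)).
      by move=> /andP[h1 h2]; rewrite !ger0_norm ?subr_ge0//; lra.
    have := lip _ _ (ltW st).
    by move=> /andP[h1 h2]; rewrite !ger0_norm ?subr_ge0 ?(ltW st)//; lra.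
  move=> t; apply: cvgB; first exact: clen.
  apply: (@continuous_subspaceT _ _ _ (fun t : R => th * (t - p))) => s.
  by apply: cvgM; [exact: cvg_cst|apply: cvgB; [exact: cvg_id|exact: cvg_cst]].
have [x /[!in_itv]/= xpq xmax] := EVT_max pq cPhi.
have /andP[px xq] := xpq.
exists x; split => // t /andP[h1 h2].
  have := xmax t; rewrite in_itv/= h2 (le_trans px h1) => /(_ isT).
  by rewrite /Phi (len_split _ px h1); lra.
have := xmax t; rewrite in_itv/= h1 (le_trans h2 xq) => /(_ isT).
by rewrite /Phi (len_split _ h1 h2); lra.
Unshelve. all: by end_near. Qed.

End OuterMeasure.

(** * Density and approximate continuity in terms of lengths *)

Section Density.
Variable R : realType.
Implicit Types (E A : set R) (x : R).
Local Notation mu := (@completed_lebesgue_measure R).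

(** Zero density of [E] at [x]: the endpoint of the interval and the factor [2] in
    its length are absorbed by [e]. *)
Definition thin E x := forall e, 0 < e ->
  exists2 rho, 0 < rho & forall h, 0 < h <= rho ->
    len E (x - h) (x + h) <= e * h.

Definition right_thin E x := forall e, 0 < e ->
  exists2 rho, 0 < rho & forall h, 0 < h <= rho -> len E x (x + h) <= e * h.

Lemma density_leE E x r e : 0 < r ->
  (density E `](x - r)%R, (x + r)%R[ <= e%:E)%E =
  (mu (E `&` `](x - r)%R, (x + r)%R[) <= (e * (2 * r))%:E)%E.
Proof.
move=> r0; rewrite /density mu_itv_oo; last by lra.
have -> : x + r - (x - r) = 2 * r by lra.
have r2 : 0 < 2 * r by lra.
by rewrite inver gt_eqF// lee_pdivrMr// EFinM.
Qed.

Lemma zero_density_thin E x : zero_density E x -> thin E x.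
Proof.
move=> [E0 _] e e0.
have : (upper_density E x < (e / 4)%:E)%E by rewrite E0 lte_fin; lra.
rewrite /upper_density limf_esupE => /ereal_inf_lt[_ [V V0 <-]] supV.
have [rho /= rho0 rhoV] := V0.
exists (rho / 3); first lra.
move=> h /andP[h0 hr].
have : (density E `](x - 2 * h)%R, (x + 2 * h)%R[ <= (e / 4)%:E)%E.
  apply: le_trans (ltW supV); apply: ereal_sup_ubound.
  (* the open interval of radius [2 * h] contains the half-open one *)
  exists (2 * h) => //; apply: rhoV; last by rewrite /=; lra.
  by rewrite /= sub0r normrN gtr0_norm; lra.
rewrite density_leE; last by lra.
move=> /(le_trans (le_mu _)) => /(_ (E `&` `]x - h, x + h]%classic)).
rewrite lenE lee_fin => /(_ _)/le_trans; apply; last by lra.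
move=> y [Ey /=]; rewrite !in_itv/= => /andP[h1 h2]; split=> //.
by apply/andP; split; lra.
Qed.

Lemma thin_zero_density E x : thin E x -> zero_density E x.
Proof.
move=> thinE; pose g r := density E `]x - r, x + r[.
have g0 r : 0 < r -> (0 <= g r)%E.
  move=> r0; rewrite /g /density mu_itv_oo; last by lra.
  by rewrite inver gt_eqF ?mule_ge0 ?mu_ge0 ?lee_fin ?invr_ge0//; lra.
have gle e : 0 < e -> (\forall r \near 0^'+, g r <= e%:E)%E.
  move=> e0; have [rho rho0 small] := thinE e e0.
  near=> r.
  have r0 : 0 < r by near: r; exact: nbhs_right_gt.
  have rr : r <= rho by near: r; exact: nbhs_right_le.
  rewrite /g density_leE//.
  apply: (@le_trans _ _ (mu (E `&` `]x - r, x + r]))); first apply: le_mu.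
    by move=> y [Ey /=]; rewrite !in_itv/= => /andP[-> /ltW].
  rewrite lenE lee_fin (le_trans (small r _))//; first by rewrite r0.
  by have := mulr_gt0 e0 r0; lra.
have up : (upper_density E x <= 0)%E.
  apply/lee_addgt0Pr => e e0; rewrite add0e /upper_density limf_esupE.
  apply: ge_ereal_inf; eexists.
    by exists [set r | g r <= e%:E]%E; [exact: gle e0|].
  by apply: ge_ereal_sup => _ [r gr <-].
have low : (0 <= lower_density E x)%E.
  rewrite /lower_density limf_einfE; apply: le_ereal_sup_tmp; eexists.
    by exists [set r | 0 < r] => //; exact: nbhs_right_gt.
  by apply: le_ereal_inf_tmp => _ [r r0 <-]; exact: g0.
have lu : (lower_density E x <= upper_density E x)%E.
  rewrite /lower_density /upper_density limf_einfE limf_esupE.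
  apply: ge_ereal_sup => _ [V V0 <-]; apply: le_ereal_inf_tmp => _ [W W0 <-].
  have [r [Vr Wr]] : exists r, V r /\ W r by exact: filter_ex (filterI V0 W0).
  apply: (@le_trans _ _ (g r)).
    by apply: ereal_inf_lbound; exists r.
  by apply: ereal_sup_ubound; exists r.
split; apply: le_anti; apply/andP; split => //.
- exact: le_trans lu.
- exact: le_trans up.
Unshelve. all: by end_near. Qed.

(** Off the exceptional set [E] of zero density, [f y] is in [U] as soon as [y] is
    close to [x], hence [A] is contained in [E] near [x]. *)
Lemma approx_continuous_thin (f : R -> R) A (U : set R) x :
  approx_continuous_at `[0, 1] f x -> nbhs (f x) U ->
  (forall y, A y -> 0 <= y <= 1 /\ ~ U (f y)) -> thin A x.
Proof.
move=> [E [_ /zero_density_thin thinE cE]] Ux AU e e0.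
have [rho1 rho10 small] := thinE e e0.
have [rho2 /= rho20 near2] := cE U Ux.
exists (Num.min rho1 (rho2 / 2)); first by rewrite lt_min rho10; lra.
move=> h; rewrite le_min => /and3P[h0 h1 h2].
apply: le_trans (small h _); last by rewrite h0.
apply: le_len => y [Ay yh]; split=> //; have [y01 nU] := AU y Ay.
have xy : y != x by apply: contra_notN nU => /eqP ->; exact: nbhs_singleton.
apply: contrapT => nE; apply: nU; apply: near2 => //=.
move: yh; rewrite /= in_itv/= => /andP[? ?].
by rewrite distrC ltr_norml; apply/andP; split; lra.
Qed.

Lemma measurable_superlevel (f : R -> R) c :
  lebesgue_measurable_fun `[0, 1] f ->
  lebesgue_measurable [set y | 0 <= y <= 1 /\ c <= f y].
Proof.
move=> mf; have m01 : lebesgue_measurable (`[0, 1]%classic : set R).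
  apply: sub_caratheodory; exact: measurable_itv.
have -> : [set y | 0 <= y <= 1 /\ c <= f y] = `[0, 1] `&` f @^-1` `[c, +oo[.
  by apply/seteqP; split=> y /=; rewrite !in_itv/= andbT.
apply: mf => //; apply: sub_caratheodory; exact: measurable_itv.
Qed.

Lemma upper_right_derivate_le0 (f : R -> R) x E d : 0 < d ->
  (forall h, 0 < h < d -> x + h <= 1 -> ~ E h -> f (x + h) <= f x) ->
  0 <= x -> (upper_right_derivate_off `[0%R, 1%R] f x E <= 0)%E.
Proof.
move=> d0 fle x0; rewrite /upper_right_derivate_off limf_esupE.
pose V := [set h : R | ~ E h /\ 0 < h < d /\ x + h <= 1].
apply: ge_ereal_inf; eexists; first exists V => //.
  suff : \forall h \near 0^'+,
    (~` E `&` [set h : R | `[0, 1]%classic (x + h)]) h -> V h by [].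
  near=> h => -[nE]; rewrite /= in_itv/= => /andP[_ xh1].
  have h0 : 0 < h by near: h; exact: nbhs_right_gt.
  have hd : h < d by near: h; exact: nbhs_right_lt.
  by rewrite /V/= h0 hd.
apply: ge_ereal_sup => _ [h [nE [/andP[h0 hd] xh1]] <-].
rewrite lee_fin ler_pdivrMr// mul0r subr_le0.
by apply: fle => //; rewrite h0.
Unshelve. all: by end_near. Qed.

End Density.

Lemma halving_small (R : realType) (u : nat -> R) : u 0%N <= 1 ->
  (forall n, 0 <= u n) -> (forall n, u n.+1 <= u n / 2) ->
  forall e, 0 < e -> exists N, forall n, (N <= n)%N -> u n < e.
Proof.
move=> u0 upos uhalf e e0.
have bnd n : u n * n.+1%:R <= 1.
  elim: n => [|n IH]; first by rewrite mulr1.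
  have n0 : 0 <= n%:R :> R by [].
  have := mulr_ge0 (upos n) n0.
  have := ler_wpM2r (ler0n R n.+2) (uhalf n).
  rewrite -(natr1 n.+1) -(natr1 n) in IH *; lra.
have [N _ NP] := near_infty_natSinv_lt (PosNum e0).
exists N => n Nn; apply: le_lt_trans (NP n Nn).
by rewrite -[_^-1]mul1r ler_pdivlMr ?ltr0n.
Qed.

(** * Points with a sparse superlevel set on the right *)

Section SparsePoints.
Variables (R : realType) (f : R -> R).

Definition superlevel (c : R) : set R := [set y | 0 <= y <= 1 /\ c <= f y].
Definition sublevel (c : R) : set R := [set y | 0 <= y <= 1 /\ f y < c].

Hypothesis thin_superlevel : forall x c, 0 <= x <= 1 -> f x < c ->
  thin (superlevel c) x.
Hypothesis thin_sublevel : forall x c, 0 <= x <= 1 -> c < f x ->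
  thin (sublevel c) x.
Hypothesis climb : forall x d, 0 <= x < 1 -> 0 < d ->
  exists2 y, x < y < x + d & y <= 1 /\ f x < f y.
Hypothesis thick : forall x, 0 <= x < 1 -> ~ right_thin (superlevel (f x)) x.

Lemma le_superlevel c d a b a' b' : c <= d -> a' <= a -> b <= b' ->
  len (superlevel d) a b <= len (superlevel c) a' b'.
Proof.
move=> cd aa bb; apply: le_len => y [[y01 dy] /=].
rewrite !in_itv/= => /andP[ay yb]; split.
  by split=> //; exact: le_trans dy.
by rewrite (le_lt_trans aa ay) (le_trans yb bb).
Qed.

Lemma levels_cover c a b : 0 <= a -> a <= b -> b <= 1 ->
  b - a <= len (superlevel c) a b + len (sublevel c) a b.
Proof.
move=> a0 ab b1; apply: len_cover => // y; rewrite /= in_itv/= => /andP[ay yb].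
have y01 : 0 <= y <= 1 by apply/andP; split; lra.
by have [cy|yc] := leP c (f y); [left|right].
Qed.

(** If [c < f x] then [{f < c}] has density [0] at [x], so that [{f >= c}] would
    have right density [1 > th]. *)
Lemma le_of_right_thin x q c th : 0 <= x -> x < q <= 1 -> th < 1 ->
  (forall t, x <= t <= q -> len (superlevel c) x t <= th * (t - x)) ->
  f x <= c.
Proof.
move=> x0 /andP[xq q1] th1 thin; rewrite leNgt; apply/negP => cx.
have [||rho rho0 small] := @thin_sublevel x c _ cx ((1 - th) / 2).
- by apply/andP; split; lra.
- by lra.
pose h := Num.min rho (q - x).
have h0 : 0 < h by rewrite lt_min rho0 subr_gt0.
have hq : h <= q - x by rewrite ge_min lexx orbT.
have hr : h <= rho by rewrite ge_min lexx.
have := thin (x + h); rewrite addrAC subrr add0r => /(_ ltac:(apply/andP; split; lra)).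
have := small h; rewrite h0 hr => /(_ isT).
have := @levels_cover c x (x + h) x0 ltac:(lra) ltac:(lra).
have : len (sublevel c) x (x + h) <= len (sublevel c) (x - h) (x + h).
  apply: le_len => y [cy]; rewrite /= !in_itv/= => /andP[xy yh]; split=> //.
  by rewrite yh andbT; lra.
nra.
Qed.

Lemma ge_of_left_thick x p c th : 0 <= p -> p < x <= 1 -> 0 < th ->
  (forall t, p <= t <= x -> th * (x - t) <= len (superlevel c) t x) ->
  c <= f x.
Proof.
move=> p0 /andP[px x1] th0 big; rewrite leNgt; apply/negP => cx.
have [||rho rho0 small] := @thin_superlevel x c _ cx (th / 2).
- by apply/andP; split; lra.
- by lra.
pose h := Num.min rho (x - p).
have h0 : 0 < h by rewrite lt_min rho0 subr_gt0.
have hq : h <= x - p by rewrite ge_min lexx orbT.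
have hr : h <= rho by rewrite ge_min lexx.
have := big (x - h) ltac:(apply/andP; split; lra).
have := small h; rewrite h0 hr => /(_ isT).
have : len (superlevel c) (x - h) x <= len (superlevel c) (x - h) (x + h).
  by apply: le_superlevel => //; lra.
nra.
Qed.

(** The maximum of the excess is attained neither at [q], since [f q < c], nor at
    [p], since [c < f p]. *)
Lemma level_point p q c th : 0 <= p -> p < q <= 1 -> 0 < th < 1 ->
  f q < c -> c < f p ->
  exists x, [/\ p < x < q, f x = c &
    forall t, x <= t <= q -> len (superlevel c) x t <= th * (t - x)].
Proof.
move=> p0 /andP[pq q1] /andP[th0 th1] qc cp.
have [x [/andP[px xq] right left]] := rising_sun (superlevel c) th (ltW pq).
have fxc : x < q -> f x <= c.
  move=> xq'; apply: (@le_of_right_thin x q c th) => //; last by rewrite xq'.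
  exact: le_trans px.
have cfx : p < x -> c <= f x.
  by move=> px'; apply: (@ge_of_left_thick x p c th) => //; rewrite px'/=; lra.
have xq' : x < q.
  rewrite lt_neqAle xq andbT; apply/eqP => xE.
  by have := cfx; rewrite xE => /(_ pq); lra.
have px' : p < x.
  rewrite lt_neqAle px andbT; apply/eqP => xE.
  by have := fxc xq'; rewrite -xE; lra.
exists x; split => //; first by rewrite px' xq'.
by apply/le_anti; rewrite fxc// cfx.
Qed.

(** The condition [x + r <= 1] keeps the intervals inside the domain of [f], where
    the superlevel and the sublevel set of a level are complementary. *)
Definition sparse x r th := [/\ 0 <= x, 0 < r, x + r <= 1 &
  forall h, 0 <= h <= r -> len (superlevel (f x)) x (x + h) <= th * h].

(** Rising sun at slope [4 * th], started at [x + d], stops at some [q] at most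
    [2 * d] to the right of [x], because the share [th] at [x] is too small to
    carry it further; there [f q <= f x].  A point [p] of [[x, x + d]] with
    [f x < f p] and a level [c] in between then give a [level_point] [x'] of
    [[p, q]] for the slope [th'].  Beyond [q] the share of [{f >= c}] is
    controlled from [q] up to length [2 * d], and for larger lengths it is
    controlled from [x], whose distance to [x'] does not exceed them.  Both controls
    hold because [{f >= c}] is contained in [{f >= f x}].  The last conclusion
    records that most points around [x'] have values at least [f x]. *)
Lemma sparse_step x r th th' : 0 < th -> 4 * th < 1 -> 0 < th' <= 4 * th ->
  sparse x r th ->
  exists x' r', [/\ x < x' & x' <= x + r / 8] /\ [/\ r' <= r / 8, f x < f x',
    sparse x' r' th',
    forall h, 0 <= h <= r / 2 ->
      len (superlevel (f x')) x' (x' + h) <= 4 * th * h &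
    r' <= len (superlevel (f x)) (x' - r') (x' + r')].
Proof.
move=> th0 th1 /andP[th'0 thth'] [x0 r0 xr1 thin].
pose d := r / 32; have d0 : 0 < d by rewrite /d; lra.
have rE : r = 32 * d by rewrite /d; lra.
have [q [/andP[dq qd] right left]] :=
  rising_sun (superlevel (f x)) (4 * th) (ltac:(lra) : x + d <= x + 4 * d).
have q2 : q <= x + 2 * d.
  have := left (x + d); rewrite lexx dq => /(_ isT) h1.
  have h2 : len (superlevel (f x)) (x + d) q <= len (superlevel (f x)) x q.
    by apply: le_superlevel => //; lra.
  have := thin (q - x); rewrite (addrC x) subrK.
  move=> /(_ ltac:(apply/andP; split; lra)) h3.
  have : th * (4 * (q - (x + d))) <= th * (q - x) by lra.
  by rewrite ler_pM2l//; lra.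
have fqx : f q <= f x.
  apply: (@le_of_right_thin q (x + 4 * d) _ (4 * th)) => //; first lra.
  by apply/andP; split; lra.
have [p /andP[xp pd] [p1 fxp]] := @climb x d ltac:(apply/andP; split; lra) d0.
pose c := (f x + f p) / 2.
have fxc : f x < c by rewrite /c; lra.
have cfp : c < f p by rewrite /c; lra.
have [x' [/andP[px' x'q] fx' thin']] := @level_point p q c th' ltac:(lra)
  ltac:(apply/andP; split; lra) ltac:(apply/andP; split; lra)
  ltac:(lra) cfp.
have [||rho rho0 dense] := @thin_sublevel x' (f x) _ _ 1 ltac:(lra).
- by apply/andP; split; lra.
- by rewrite fx'.
clearbody c.
pose r' := Num.min rho (Num.min (q - x') (Num.min (x' - x) d)).
have r'0 : 0 < r' by rewrite !lt_min rho0 d0 !subr_gt0 x'q (lt_trans xp px').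
have [r'rho r'q r'x r'd] : [/\ r' <= rho, r' <= q - x', r' <= x' - x & r' <= d].
  by rewrite /r' !ge_min !lexx ?orbT.
clearbody r'; exists x', r'; split; first by split; lra.
split; first lra.
- by rewrite fx'.
- split => //; [lra|lra|move=> h /andP[h0 hr]].
  rewrite fx'; have := thin' (x' + h); rewrite addrAC subrr add0r.
  by apply; apply/andP; split; lra.
- move=> h /andP[h0 hr]; rewrite fx'.
  (* the interval ends before [q], before [x + 4 * d], or beyond *)
  have [hq|qh] := leP h (q - x').
    have := thin' (x' + h); rewrite addrAC subrr add0r.
    move=> /(_ ltac:(apply/andP; split; lra)) /le_trans; apply.
    by rewrite ler_wpM2r.
  have [h4|h4] := leP (x' + h) (x + 4 * d).
    rewrite (@len_split _ _ _ q) ?(ltW x'q)//; last lra.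
    have h5 := thin' q ltac:(apply/andP; split; lra).
    have h6 := right (x' + h) ltac:(apply/andP; split; lra).
    have h7 : len (superlevel c) q (x' + h) <= len (superlevel (f x)) q (x' + h).
      by apply: le_superlevel => //; lra.
    nra.
  have h5 : len (superlevel c) x' (x' + h) <= len (superlevel (f x)) x (x' + h).
    by apply: le_superlevel => //; lra.
  have := thin (x' + h - x); rewrite (addrC x) subrK.
  move=> /(_ ltac:(apply/andP; split; lra)) h6.
  nra.
- have := dense r' ltac:(apply/andP; split; lra).
  have := @levels_cover (f x) (x' - r') (x' + r') ltac:(lra) ltac:(lra) ltac:(lra).
  lra.
Qed.

Lemma sparse_chain x0 r0 : sparse x0 r0 (1 / 16) ->
  exists x r th : nat -> R, [/\ x 0%N = x0 & r 0%N = r0] /\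
    [/\ forall n, sparse (x n) (r n) (th n),
     forall n, [/\ x n < x n.+1, x n.+1 <= x n + r n / 8, r n.+1 <= r n / 8 &
       f (x n) < f (x n.+1)],
     (forall e, 0 < e -> exists N, forall n, (N <= n)%N -> th n < e),
     forall n h, 0 <= h <= r n / 2 ->
       len (superlevel (f (x n.+1))) (x n.+1) (x n.+1 + h) <= 4 * th n * h &
     forall n, r n.+1 <=
       len (superlevel (f (x n))) (x n.+1 - r n.+1) (x n.+1 + r n.+1)].
Proof.
move=> thin0; pose state := {s : R * R * R |
  [/\ 0 < s.2, s.2 <= 1 / 16 & sparse s.1.1 s.1.2 s.2]}.
pose next (s t : state) := let: (x, r, th) := sval s in
  let: (x', r', th') := sval t in
  [/\ x < x', x' <= x + r / 8, r' <= r / 8 & f x < f x'] /\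
  [/\ th' = th / 2,
    forall h, 0 <= h <= r / 2 ->
      len (superlevel (f x')) x' (x' + h) <= 4 * th * h &
    r' <= len (superlevel (f x)) (x' - r') (x' + r')].
have nextP s : {t | next s t}.
  case: s => -[[x r] th] /= sP; apply: cid; rewrite /next/=.
  have [th0 th1 thin] := sP.
  have [||x' [r' [[xx' x'r] [r'r ff thin' mid dense]]]] :=
    @sparse_step x r th (th / 2) th0 _ _ thin.
  - by lra.
  - by apply/andP; split; lra.
  have tP : [/\ 0 < th / 2, th / 2 <= 1 / 16 & sparse x' r' (th / 2)].
    by split => //; lra.
  by exists (exist _ (x', r', th / 2) tP).
have s0P : [/\ 0 < 1 / 16 :> R, 1 / 16 <= 1 / 16 :> R & sparse x0 r0 (1 / 16)].
  by split => //; lra.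
have [u [u0 uS]] := dependent_choice nextP (exist _ (x0, r0, 1 / 16) s0P).
pose x n := (sval (u n)).1.1; pose r n := (sval (u n)).1.2.
pose th n := (sval (u n)).2.
have {}uS n : [/\ x n < x n.+1, x n.+1 <= x n + r n / 8, r n.+1 <= r n / 8 &
    f (x n) < f (x n.+1)] /\
  [/\ th n.+1 = th n / 2,
    forall h, 0 <= h <= r n / 2 ->
      len (superlevel (f (x n.+1))) (x n.+1) (x n.+1 + h) <= 4 * th n * h &
    r n.+1 <= len (superlevel (f (x n))) (x n.+1 - r n.+1) (x n.+1 + r n.+1)].
  move: (uS n); rewrite /next /x /r /th.
  by case: (sval (u n)) => -[? ?] ?; case: (sval (u n.+1)) => -[? ?] ?.
have uP n : [/\ 0 < th n, th n <= 1 / 16 & sparse (x n) (r n) (th n)].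
  exact: svalP (u n).
exists x, r, th; split; first by rewrite /x /r u0.
split.
- by move=> n; have [] := uP n.
- by move=> n; have [] := uS n.
- apply: halving_small => [|n|n].
  + by have [_ ? _] := uP 0%N; lra.
  + by have [/ltW] := uP n.
  + by have [_ [->]] := uS n.
- by move=> n; have [_ []] := uS n.
- by move=> n; have [_ []] := uS n.
Qed.

(** At the limit [z] of the chain, the scales between [r n.+1 / 4] and [r n / 4]
    are controlled from [x n.+1], which is closer to [z] than these scales, with
    share [8 * th n]. *)
Lemma no_sparse_point x0 r0 : ~ sparse x0 r0 (1 / 16).
Proof.
move=> /sparse_chain[x [r [th [_ [thin xS th_small mid dense]]]]].
have [x00 r00 xr1 _] := thin 0%N.
have rpos n : 0 < r n by have [] := thin n.
have r_small : forall e, 0 < e -> exists N, forall n, (N <= n)%N -> r n < e.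
  apply: halving_small => [|n|n]; first lra; first exact/ltW.
  by have [_ _ + _] := xS n; have := rpos n; lra.
have xle m n : (m <= n)%N -> x m <= x n.
  apply: (@homo_leq _ x (fun a b => a <= b)) => // [u v w|k].
    exact: le_trans.
  by have [/ltW] := xS k.
have fle m n : (m <= n)%N -> f (x m) <= f (x n).
  apply: (@homo_leq _ (f \o x) (fun a b => a <= b)) => // [u v w|k].
    exact: le_trans.
  by have [_ _ _ /ltW] := xS k.
have yle m n : (m <= n)%N -> x n + r n / 4 <= x m + r m / 4.
  apply: (@homo_leq _ (fun n => x n + r n / 4) (fun a b => b <= a)) => //.
    by move=> u v w uv wu; exact: le_trans uv.
  by move=> k; have [_ ? ? _] := xS k; have := rpos k; lra.
have xy m n : x m <= x n + r n / 4.
  apply: (@le_trans _ _ (x (maxn m n))); first by rewrite xle ?leq_maxl.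
  apply: (@le_trans _ _ (x (maxn m n) + r (maxn m n) / 4)).
    by have := rpos (maxn m n); lra.
  by rewrite yle ?leq_maxr.
(* [x n] increases and [x n + r n / 4] decreases; [z] lies in all these
   intervals *)
pose z := sup (range x).
have xz n : x n <= z.
  apply: ub_le_sup; last by exists n.
  by exists (x 0%N + r 0%N / 4) => _ [m _ <-].
have zy n : z <= x n + r n / 4.
  by apply: ge_sup => [|_ [m _ <-]//]; exists (x 0%N); exists 0%N.
have z01 : 0 <= z < 1.
  by apply/andP; split; [exact: le_trans (xz 0%N)|have := zy 0%N; lra].
have fxz m : f (x m) <= f z.
  rewrite leNgt; apply/negP => fzx.
  have [||rho rho0 small] := @thin_superlevel z (f (x m)) _ fzx (1 / 4).
  - by case/andP: z01 => -> /ltW.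
  - by lra.
  have [N NP] := @r_small (rho / 2) ltac:(lra).
  (* [f z < f (x m)] would make [{f >= f (x m)}] negligible around [z] at the
     scale [r n.+1] where it has share at least one half around [x n.+1] *)
  pose n := maxn m N.
  have rn : r n.+1 < rho / 2.
    by apply: NP; rewrite (leq_trans (leq_maxr m N)).
  have := rpos n.+1; have := xz n.+1; have := zy n.+1 => zr xz' rp.
  have := small (2 * r n.+1) ltac:(apply/andP; split; lra).
  have := dense n.
  have : len (superlevel (f (x n))) (x n.+1 - r n.+1) (x n.+1 + r n.+1) <=
      len (superlevel (f (x m))) (z - 2 * r n.+1) (z + 2 * r n.+1).
    by apply: le_superlevel; [exact/fle/leq_maxl|lra|lra].
  lra.
apply: (@thick z z01) => e e0.
have [N NP] := @th_small (e / 8) ltac:(lra).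
exists (r N / 4); first by have := rpos N; lra.
move=> h /andP[h0 hN].
(* the first scale of the chain below [4 * h]; the scale before it is not *)
have exk : exists k, r (N + k)%N / 4 < h.
  have [M MP] := @r_small (4 * h) ltac:(lra).
  by exists M; have := MP (N + M)%N (leq_addl _ _); lra.
case: (ex_minnP exk) => -[|k] rk kmin.
  by move: rk; rewrite addn0; lra.
have hk : h <= r (N + k)%N / 4.
  by rewrite leNgt; apply/negP => /kmin; rewrite ltnn.
move: rk; rewrite addnS; set n := (N + k)%N => rk.
have := mid n (2 * h) ltac:(apply/andP; split; lra).
have : len (superlevel (f z)) z (z + h) <=
    len (superlevel (f (x n.+1))) (x n.+1) (x n.+1 + 2 * h).
  by apply: le_superlevel => //; have := zy n.+1; lra.
have := NP n (leq_addr _ _).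
nra.
Qed.

Lemma nondecreasing a b : 0 <= a -> a < b -> b <= 1 -> f a <= f b.
Proof.
move=> a0 ab b1; rewrite leNgt; apply/negP => fba.
have [||||x [/andP[ax xb] fx thin]] :=
  @level_point a b ((f a + f b) / 2) (1 / 16) a0.
- by rewrite ab.
- by apply/andP; split; lra.
- by lra.
- by lra.
apply: (@no_sparse_point x (b - x)); split; [lra|lra|lra|].
move=> h /andP[h0 hb]; rewrite fx.
have := thin (x + h); rewrite addrAC subrr add0r; apply.
by apply/andP; split; lra.
Qed.

Lemma strictly_increasing a b : 0 <= a -> a < b -> b <= 1 -> f a < f b.
Proof.
move=> a0 ab b1.
have [||y /andP[ay yb] [_ fay]] := @climb a (b - a).
- by apply/andP; split; lra.
- by lra.
by apply: lt_le_trans fay _; apply: nondecreasing => //; lra.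
Qed.

End SparsePoints.

(** * Strict monotonicity *)

Theorem theorem1 (R : realType) (f : R -> R)
  (mf : lebesgue_measurable_fun `[0, 1] f)
  (cf : approx_continuous `[0, 1] f)
  (df : forall (x0 : R) (E : set R), x0 \in `[0, 1[ ->
    lebesgue_measurable E -> zero_density E 0 ->
    (0 < upper_right_derivate_off `[0%R, 1%R] f x0 E)%E) :
  {in `[0, 1] &, {homo f : x y / x < y}}.
Proof.
have approx x : 0 <= x <= 1 -> approx_continuous_at `[0, 1] f x.
  by move=> x01; apply: cf; rewrite /= in_itv.
have climb x d : 0 <= x < 1 -> 0 < d ->
    exists2 y, x < y < x + d & y <= 1 /\ f x < f y.
  move=> x01 d0; apply: contrapT => no.
  have zd0 : zero_density (set0 : set R) 0.
    by apply: thin_zero_density => e e0; exists 1 => // h /andP[h0 _];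
      rewrite len_set0 mulr_ge0// ltW.
  have m0 : lebesgue_measurable (set0 : set R) by exact: measurable0.
  have := df x set0 ltac:(by rewrite in_itv) m0 zd0.
  rewrite ltNge => /negP; apply.
  apply: (@upper_right_derivate_le0 _ f x set0 d) => //; last by case/andP: x01.
  move=> h /andP[h0 hd] xh _; rewrite leNgt; apply/negP => fxh; apply: no.
  by exists (x + h) => //; apply/andP; split; lra.
have thick x : 0 <= x < 1 -> ~ right_thin (superlevel f (f x)) x.
  move=> x01 small.
  (* off this [E], the difference quotient at [x] is negative on the right *)
  pose E := [set h | superlevel f (f x) (x + h)] `&` `]0, 1].
  have mE : lebesgue_measurable E.
    apply: measurableI.
      exact/lebesgue_measurable_translate/measurable_superlevel.
    by apply: sub_caratheodory; exact: measurable_itv.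
  have zE : zero_density E 0.
    apply: thin_zero_density => e e0; have [rho rho0 rhoP] := small e e0.
    exists rho => // h h0; apply: le_trans (rhoP h h0).
    rewrite -len_translate sub0r add0r; apply: le_len.
    by move=> y [[Ey]]; rewrite /= !in_itv/= => /andP[-> _] /andP[_ ->].
  have := df x E ltac:(by rewrite in_itv) mE zE.
  rewrite ltNge => /negP; apply.
  apply: (@upper_right_derivate_le0 _ f x E 1) => //; last by case/andP: x01.
  move=> h /andP[h0 h1] xh nE; rewrite leNgt; apply/negP => fxh; apply: nE.
  split; last by rewrite /= in_itv/= h0 ltW.
  by split; [apply/andP; split; lra|exact: ltW].
have thin_sup x c : 0 <= x <= 1 -> f x < c -> thin (superlevel f c) x.
  move=> x01 fxc; apply: (@approx_continuous_thin _ f _ [set y | y < c]).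
  - exact: approx.
  - exact: lt_nbhsl.
  - by move=> y [y01 cy]; split=> //=; rewrite ltNge cy.
have thin_sub x c : 0 <= x <= 1 -> c < f x -> thin (sublevel f c) x.
  move=> x01 fxc; apply: (@approx_continuous_thin _ f _ [set y | c < y]).
  - exact: approx.
  - exact: lt_nbhsr.
  - by move=> y [y01 cy]; split=> //=; rewrite ltNge (ltW cy).
move=> a b; rewrite !in_itv/= => /andP[a0 _] /andP[_ b1] ab.
exact: (@strictly_increasing R f thin_sup thin_sub climb thick).
Qed.
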